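(* Let $\kappa\in\mathbb{R}$ and $c\in\mathbb{C}$ with $c\ne0$ be such that $\kappa$ is not a nonpositive integer (i.e. $\kappa\ne0,-1,-2,\ldots$) and $$\frac{2\kappa}{e}\bigl(4\sin(1)+3-e\bigr)\geq(e+1)|c|+4(e-1)^3+6(e-1)^2+\frac6e-\frac{12}{e^2}.$$ Then the function $6\kappa(1-\mathfrak{u}_\nu)/c$ belongs to $\mathscr{K}_e$.
   Context: $\mathbb{D}=\{z\in\mathbb{C}:|z|<1\}$. For analytic functions $f,g$ on $\mathbb{D}$, $f\prec g$ ($f$ is subordinate to $g$) means there is an analytic $w:\mathbb{D}\to\mathbb{C}$ with $w(0)=0$, $|w(z)|<1$ for all $z\in\mathbb{D}$ and $f=g\circ w$. $\mathscr{P}_e$ is the family of analytic functions $p$ in $\mathbb{D}$ with $p(0)=1$ and $p(z)\prec e^z$. $\mathscr{A}$ is the class of analytic functions $f$ on $\mathbb{D}$ with $f(0)=0$, $f'(0)=1$. $\mathscr{K}_e$ (exponential convex functions) is the class of $f\in\mathscr{A}$ such that $1+zf''(z)/f'(z)$ belongs to $\mathscr{P}_e$. For $b,c,\nu\in\mathbb{C}$, set $\kappa=\nu+(b+2)/2$, assumed $\ne0,-1,-2,\ldots$. The generalized Struve function of the first kind of order $\nu$ is $\mathfrak{w}_{\nu,b,c}(z)=\sum_{n\ge0}\frac{(-c)^n}{\Gamma(n+3/2)\Gamma(\nu+n+(b+2)/2)}\left(\frac z2\right)^{2n+\nu+1}$, and its normalization $\mathfrak{u}_\nu=\mathfrak{u}_{\nu,b,c}$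 is $\mathfrak{u}_{\nu}(z)=2^\nu\sqrt\pi\,\Gamma(\kappa)z^{-(\nu+1)/2}\mathfrak{w}_{\nu,b,c}(\sqrt z)$, i.e. the entire function $$\mathfrak{u}_\nu(z)=\sum_{n\ge0}\frac{(-c/4)^n}{(3/2)_n(\kappa)_n}z^n,$$ where $(x)_0=1$, $(x)_n=x(x+1)\cdots(x+n-1)$; it depends only on $\kappa$ and $c$. *)

(* Defs.v *)
From Stdlib Require Import Reals.
From Coquelicot Require Import Coquelicot.

Local Open Scope C_scope.

Definition Cexp (z : C) : C := (exp (Re z) * cos (Im z), exp (Re z) * sin (Im z))%R.

(* Coquelicot's [Series] is only defined for real terms. *)
Definition CSeries (a : nat -> C) : C :=
  (Series (fun n => Re (a n)), Series (fun n => Im (a n))).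

Lemma CSeries_unique (a : nat -> C) (l : C) :
  @is_series C_AbsRing C_NormedModule a l -> CSeries a = l.
Proof.
  intros H.
  assert (Hsum : forall n,
    @sum_n C_NormedModule a n
    = (sum_n (fun k => Re (a k)) n, sum_n (fun k => Im (a k)) n)).
  { induction n as [|n IH].
    - rewrite !sum_O. now destruct (a O).
    - rewrite !sum_Sn, IH. reflexivity. }
  unfold CSeries. rewrite (surjective_pairing l).
  f_equal; apply is_series_unique; intros P [eps HP];
    (assert (HQ : @locally C_UniformSpace l (fun z => ball (fst l) eps (fst z)
                                               /\ ball (snd l) eps (snd z)))
      by (exists eps; intros z Hz; exact Hz));
    destruct (H _ HQ) as [N HN]; exists N; intros n Hn;
    destruct (HN n Hn) as [H1 H2]; apply HP.
  - exact (eq_ind _ (fun t : R => ball (fst l) eps t) H1 _ (f_equal fst (Hsum n))).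
  - exact (eq_ind _ (fun t : R => ball (snd l) eps t) H2 _ (f_equal snd (Hsum n))).
Qed.

Definition unit_disk (z : C) : Prop := (Cmod z < 1)%R.

(* Analytic functions on the disk are represented by total functions
   [C -> C], whose values outside the disk are irrelevant. *)
Definition analytic_on_disk (f : C -> C) : Prop :=
  forall z, unit_disk z -> @ex_derive C_AbsRing C_NormedModule f z.

Definition subordinate (f g : C -> C) : Prop :=
  exists w : C -> C,
    analytic_on_disk w /\ w 0 = 0 /\
    (forall z, unit_disk z -> (Cmod (w z) < 1)%R) /\
    (forall z, unit_disk z -> f z = g (w z)).

Definition class_Pe (p : C -> C) : Prop :=
  analytic_on_disk p /\ p 0 = 1 /\ subordinate p Cexp.

Definition class_A (f : C -> C) : Prop :=
  analytic_on_disk f /\ f 0 = 0 /\ C_derive f 0 = 1.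

(* Division in [C] is total, so the condition that the quotient f''/f' be
   defined throughout the disk is made explicit. *)
Definition class_Ke (f : C -> C) : Prop :=
  class_A f /\
  (forall z, unit_disk z -> C_derive f z <> 0) /\
  class_Pe (fun z => 1 + z * C_derive (C_derive f) z / C_derive f z).

Fixpoint pochhammer (x : C) (n : nat) : C :=
  match n with
  | O => 1
  | S m => pochhammer x m * (x + INR m)
  end.

Definition struve_kappa (nu b : C) : C := nu + (b + 2) / 2.

(* Normalized generalized Struve function: the power series of
   2^nu sqrt(pi) Gamma(kappa) z^(-(nu+1)/2) w_(nu,b,c)(sqrt z). *)
Definition struve_u (nu b c z : C) : C :=
  CSeries (fun n =>
    (- c / 4) ^ n / (pochhammer (3 / 2) n * pochhammer (struve_kappa nu b) n)
    * z ^ n).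

(* Main.v *)
Require Import Defs.
From Stdlib Require Import Reals Lra.
From Coquelicot Require Import Coquelicot.
Local Open Scope R_scope.

(** The hypothesis forces [kappa > 0] and [|c| <= kappa]
    ([struve_parameter_bounds]), and then the function
    [f = 6 kappa (1 - u) / c = z + ...] is very close to the identity:
    consecutive coefficients have ratio
    [(- c / 4) / ((5/2 + n) (kappa + 1 + n))], of modulus at most [1/10]. Hence
    the coefficient of [z^(n+1)] is at most [10^(-n)], the power series for
    [f'] and [f''] give [|z f'' / f'| < 2/5] on the disk
    ([class_Ke_of_coef]), and [p = 1 + z f'' / f'] stays in the disk of radius
    [2/5] around 1. There the principal logarithm is analytic with modulus less
    than 1, so [w = log p] exhibits [p] as subordinate to the exponential
    ([class_Pe_near_1]).

    Two pieces of complex analysis support this. Termwise differentiation of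
    power series ([is_Cderive_PS]) is elementary here because only coefficients
    decaying geometrically occur: the second-order remainder of [z^n] on the
    closed disk is at most [n^2 |h|^2], and the sum of [n^2 |a n|] converges.
    The derivative of the logarithm ([is_Cderive_Clog]) follows from its real
    and imaginary parts through the Cauchy-Riemann equations. *)

(** * Complex differentiability *)

Local Notation is_Cderive := (@is_derive C_AbsRing C_NormedModule).

Lemma is_linear_Cmult (l : C) :
  @is_linear C_AbsRing (AbsRing_NormedModule C_AbsRing) C_NormedModule
    (fun h : C => (h * l)%C).
Proof. exact (@is_linear_scal_l C_AbsRing C_NormedModule l). Qed.

(** The library phrases differentiability through filters and linear maps; this
    epsilon-delta form is what the hands-on estimates below produce. *)
Lemma is_Cderive_iff (f : C -> C) (z l : C) :
  is_Cderive f z l <->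
  forall eps : R, 0 < eps -> exists del : R, 0 < del /\
    forall w : C, Cmod (w - z) < del ->
      Cmod (f w - f z - (w - z) * l) <= eps * Cmod (w - z).
Proof.
  split.
  - intros [_ H] eps Heps.
    destruct (H z (fun P HP => HP) (mkposreal eps Heps)) as [d Hd].
    exists d; split; [apply cond_pos|].
    intros w Hw. exact (Hd w Hw).
  - intros H. split; [apply is_linear_Cmult|].
    intros x Hx.
    assert (E : z = x) by
      exact (@is_filter_lim_locally_unique C_AbsRing (AbsRing_NormedModule C_AbsRing) z x Hx).
    rewrite <- E. intros eps.
    destruct (H eps (cond_pos eps)) as [d [Hd1 Hd2]].
    exists (mkposreal d Hd1). intros w Hw. exact (Hd2 w Hw).
Qed.

Lemma is_Cderive_ext_loc (f g : C -> C) (z l : C) (r : R) :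
  0 < r -> (forall w, Cmod (w - z) < r -> f w = g w) ->
  is_Cderive f z l -> is_Cderive g z l.
Proof.
  intros Hr E H. apply (is_derive_ext_loc f); [|exact H].
  exists (mkposreal r Hr). intros w Hw. apply E. exact Hw.
Qed.

Lemma is_Cderive_plus (f g : C -> C) (z a b : C) : is_Cderive f z a -> is_Cderive g z b ->
  is_Cderive (fun w => (f w + g w)%C) z (a + b)%C.
Proof. intros H1 H2. exact (is_derive_plus f g z a b H1 H2). Qed.

Lemma is_Cderive_id z : is_Cderive (fun w => w) z (RtoC 1).
Proof.
  apply is_Cderive_iff. intros eps Heps. exists 1; split; [lra|]. intros w _.
  replace (w - z - (w - z) * RtoC 1)%C with (RtoC 0) by ring.
  rewrite Cmod_0. pose proof (Cmod_ge_0 (w - z)%C). nra.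
Qed.

(** Seen as a module over itself through its ring structure and as a plane, [C]
    carries two formally different normed-module structures. The product and
    chain rules of the library need the first one, the definition of analytic
    functions uses the second; the norms agree, hence so do the derivatives. *)
Lemma is_Cderive_iff_ring (f : C -> C) (z l : C) :
  is_Cderive f z l <-> @is_derive C_AbsRing (AbsRing_NormedModule C_AbsRing) f z l.
Proof.
  split; intros [_ H]; split.
  - exact (@is_linear_scal_l C_AbsRing (AbsRing_NormedModule C_AbsRing) l).
  - exact H.
  - apply is_linear_Cmult.
  - exact H.
Qed.

Lemma is_Cderive_mult (f g : C -> C) (z a b : C) : is_Cderive f z a -> is_Cderive g z b ->
  is_Cderive (fun w => (f w * g w)%C) z (a * g z + f z * b)%C.
Proof.
  rewrite !is_Cderive_iff_ring. intros H1 H2.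
  exact (is_derive_mult f g z a b H1 H2 Cmult_comm).
Qed.

Lemma is_Cderive_comp (f g : C -> C) (z a b : C) :
  is_Cderive f (g z) a -> is_Cderive g z b ->
  is_Cderive (fun w => f (g w)) z (b * a)%C.
Proof.
  intros H1 H2. apply is_Cderive_iff_ring in H2.
  exact (is_derive_comp f g z a b H1 H2).
Qed.

(** A real linear map of the plane whose matrix satisfies the Cauchy-Riemann
    equations is multiplication by [p + i q], so the two real first-order
    expansions add up to a complex one. *)
Lemma cauchy_riemann (U V : R -> R -> R) (z : C) (p q : R) :
  differentiable_pt_lim U (Re z) (Im z) p (- q) ->
  differentiable_pt_lim V (Re z) (Im z) q p ->
  is_Cderive (fun w : C => (U (Re w) (Im w), V (Re w) (Im w))) z (p, q).
Proof.
  intros HU HV. apply is_Cderive_iff. intros eps Heps.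
  assert (He : 0 < eps / 2) by lra.
  destruct (HU (mkposreal _ He)) as [d1 H1].
  destruct (HV (mkposreal _ He)) as [d2 H2].
  exists (Rmin d1 d2). split; [apply Rmin_pos; apply cond_pos|].
  intros w Hw.
  pose proof (Rmin_l d1 d2). pose proof (Rmin_r d1 d2).
  pose proof (Rmax_Cmod (w - z)%C) as Hm.
  pose proof (Rmax_l (Rabs (fst (w - z)%C)) (Rabs (snd (w - z)%C))).
  pose proof (Rmax_r (Rabs (fst (w - z)%C)) (Rabs (snd (w - z)%C))).
  change (fst (w - z)%C) with (Re w - Re z) in *.
  change (snd (w - z)%C) with (Im w - Im z) in *.
  specialize (H1 (Re w) (Im w) ltac:(lra) ltac:(lra)).
  specialize (H2 (Re w) (Im w) ltac:(lra) ltac:(lra)).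
  simpl in H1, H2.
  set (A := U _ _ - _ - _) in H1. set (B := V _ _ - _ - _) in H2.
  replace ((U (Re w) (Im w), V (Re w) (Im w)) - (U (Re z) (Im z), V (Re z) (Im z)) - (w - z) * (p, q))%C
    with (RtoC A + Ci * RtoC B)%C.
  - eapply Rle_trans; [apply Cmod_triangle|].
    rewrite Cmod_mult, Cmod_Ci, !Cmod_R. nra.
  - unfold A, B, Re, Im. apply injective_projections; simpl; ring.
Qed.

(** The error of the linear approximation is exactly [h^2 / (z^2 w)] with
    [h = w - z], and [w] stays away from 0 when [|h| <= |z| / 2]. *)
Lemma is_Cderive_inv (z : C) : z <> RtoC 0 -> is_Cderive Cinv z (- / (z * z))%C.
Proof.
  intros Hz. apply is_Cderive_iff. intros eps Heps.
  assert (Hp := proj1 (Cmod_gt_0 z) Hz). set (m := Cmod z) in *.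
  exists (Rmin (m / 2) (eps * (m ^ 3 / 2))).
  assert (0 < m ^ 3) by (apply pow_lt; lra).
  split; [apply Rmin_pos; [lra|apply Rmult_lt_0_compat; lra]|].
  intros w Hw.
  pose proof (Rmin_l (m / 2) (eps * (m ^ 3 / 2))). pose proof (Rmin_r (m / 2) (eps * (m ^ 3 / 2))).
  assert (Hwm : m / 2 <= Cmod w).
  { pose proof (Cmod_triangle w (z - w)%C) as T.
    replace (w + (z - w))%C with z in T by ring.
    replace (z - w)%C with (- (w - z))%C in T by ring. rewrite Cmod_opp in T.
    fold m in T. lra. }
  assert (w <> RtoC 0) by (apply Cmod_gt_0; lra).
  replace (/ w - / z - (w - z) * - / (z * z))%C
    with ((w - z) * (w - z) / (z * z * w))%C by (field; auto).
  rewrite Cmod_div by (apply Cmod_gt_0; rewrite !Cmod_mult; fold m;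
    apply Rmult_lt_0_compat; nra).
  rewrite !Cmod_mult. fold m.
  set (h := Cmod (w - z)) in *. assert (0 <= h) by apply Cmod_ge_0.
  assert (0 < m * m * Cmod w) by (apply Rmult_lt_0_compat; nra).
  apply Rle_div_l; [lra|].
  assert (m ^ 3 / 2 <= m * m * Cmod w) by (simpl; nra).
  rewrite (Rmult_comm eps), Rmult_assoc. apply Rmult_le_compat_l; [lra|]. nra.
Qed.

(** * The complex logarithm on the right half-plane *)

(** This formula is the principal branch only where the real part is positive. *)
Definition Clog (z : C) : C :=
  (ln (Re z * Re z + Im z * Im z) / 2, atan (Im z / Re z)).

Lemma Cexp_Clog (z : C) : 0 < Re z -> Cexp (Clog z) = z.
Proof.
  destruct z as [x y]. unfold Cexp, Clog. cbn [Re Im fst snd]. intros Hx.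
  assert (Hs : 0 < x * x + y * y) by nra.
  assert (Hexp : exp (ln (x * x + y * y) / 2) = x * sqrt (1 + Rsqr (y / x))).
  { replace (x * x + y * y) with ((x * x) * (1 + Rsqr (y / x)))
      by (unfold Rsqr; field; lra).
    assert (0 <= Rsqr (y / x)) by apply Rle_0_sqr.
    assert (Hq : 0 < sqrt (1 + Rsqr (y / x))) by (apply sqrt_lt_R0; lra).
    rewrite <- (sqrt_sqrt (1 + Rsqr (y / x))) at 1 by lra.
    set (q := sqrt _) in *.
    replace (x * x * (q * q)) with ((x * q) * (x * q)) by ring.
    rewrite ln_mult by nra.
    replace ((ln (x * q) + ln (x * q)) / 2) with (ln (x * q)) by field.
    apply exp_ln. nra. }
  rewrite Hexp, cos_atan, sin_atan.
  assert (0 < sqrt (1 + Rsqr (y / x))).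
  { apply sqrt_lt_R0. pose proof (Rle_0_sqr (y / x)). lra. }
  f_equal; field; lra.
Qed.

Lemma Clog_1 : Clog (RtoC 1) = RtoC 0.
Proof.
  unfold Clog, RtoC. cbn [Re Im fst snd].
  replace (1 * 1 + 0 * 0) with 1 by ring. rewrite ln_1.
  replace (0 / 1) with 0 by field. rewrite atan_0. f_equal; field.
Qed.

Lemma differentiable_pt_lim_Rplus (f g : R -> R -> R) (x y a b a' b' : R) :
  differentiable_pt_lim f x y a b -> differentiable_pt_lim g x y a' b' ->
  differentiable_pt_lim (fun u v => f u v + g u v) x y (a + a') (b + b').
Proof.
  rewrite <- !filterdiff_differentiable_pt_lim. intros Hf Hg.
  eapply filterdiff_ext_lin; [exact (filterdiff_plus_fct _ _ _ _ Hf Hg)|].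
  intros t. unfold plus. simpl. ring.
Qed.

Lemma differentiable_pt_lim_Rmult (f g : R -> R -> R) (x y a b a' b' : R) :
  differentiable_pt_lim f x y a b -> differentiable_pt_lim g x y a' b' ->
  differentiable_pt_lim (fun u v => f u v * g u v) x y
    (a * g x y + f x y * a') (b * g x y + f x y * b').
Proof.
  rewrite <- !filterdiff_differentiable_pt_lim. intros Hf Hg.
  eapply filterdiff_ext_lin.
  - exact (filterdiff_mult_fct _ _ _ _ _ Rmult_comm Hf Hg).
  - intros t. unfold plus, mult. simpl. ring.
Qed.

Lemma differentiable_pt_lim_comp1 (h : R -> R) (f : R -> R -> R) (x y l a b : R) :
  derivable_pt_lim h (f x y) l -> differentiable_pt_lim f x y a b ->
  differentiable_pt_lim (fun u v => h (f u v)) x y (l * a) (l * b).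
Proof.
  intros Hh Hf.
  pose proof (differentiable_pt_lim_comp (fun u _ => h u) f f x y l 0 a b a b
    (differentiable_pt_lim_proj1_0 h (f x y) (f x y) l Hh) Hf Hf) as H.
  replace (l * a) with (l * a + 0 * a) by ring.
  replace (l * b) with (l * b + 0 * b) by ring. exact H.
Qed.

Lemma differentiable_pt_lim_fst (x y : R) : differentiable_pt_lim (fun u v => u) x y 1 0.
Proof. apply (differentiable_pt_lim_proj1_0 (fun u => u)), derivable_pt_lim_id. Qed.

Lemma differentiable_pt_lim_snd (x y : R) : differentiable_pt_lim (fun u v => v) x y 0 1.
Proof.
  intros eps. exists (mkposreal 1 Rlt_0_1). intros u v _ _.
  replace (v - y - _) with 0 by ring. rewrite Rabs_R0.
  apply Rmult_le_pos; [apply Rlt_le, cond_pos|].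
  eapply Rle_trans; [apply Rabs_pos|apply Rmax_l].
Qed.

(** The partial derivatives of [ln (x^2 + y^2) / 2] and [atan (y / x)] are
    [x / |z|^2, y / |z|^2] and [- y / |z|^2, x / |z|^2]: they satisfy the
    Cauchy-Riemann equations and are the parts of [/ z]. *)
Lemma is_Cderive_Clog (z : C) : 0 < Re z -> is_Cderive Clog z (/ z)%C.
Proof.
  intros Hx. set (x := Re z) in *. set (y := Im z).
  assert (Hs : 0 < x * x + y * y) by nra.
  replace (/ z)%C with (x / (x * x + y * y), - y / (x * x + y * y)).
  2:{ unfold x, y. destruct z as [u v]. unfold Cinv. cbn [Re Im fst snd].
      simpl. f_equal; f_equal; ring. }
  pose proof (differentiable_pt_lim_fst x y) as Px.
  pose proof (differentiable_pt_lim_snd x y) as Py.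
  apply (cauchy_riemann (fun x y => ln (x * x + y * y) / 2) (fun x y => atan (y / x)));
    fold x; fold y.
  - assert (Hln : derivable_pt_lim (fun s => ln s / 2) (x * x + y * y)
                    (/ (x * x + y * y) / 2)).
    { apply is_derive_Reals. auto_derive; [exact Hs|]. field. lra. }
    pose proof (differentiable_pt_lim_comp1 _ _ _ _ _ _ _ Hln
      (differentiable_pt_lim_Rplus _ _ _ _ _ _ _ _
        (differentiable_pt_lim_Rmult _ _ _ _ _ _ _ _ Px Px)
        (differentiable_pt_lim_Rmult _ _ _ _ _ _ _ _ Py Py))) as H.
    match type of H with differentiable_pt_lim _ _ _ ?a ?b =>
      replace (x / (x * x + y * y)) with a by (field; lra);
      replace (- (- y / (x * x + y * y))) with b by (field; lra)
    end. exact H.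
  - assert (Hinv : derivable_pt_lim Rinv x (- / (x * x))).
    { apply is_derive_Reals. auto_derive; [lra|]. field. lra. }
    assert (Hat : derivable_pt_lim atan (y * / x) (x * x / (x * x + y * y))).
    { replace (x * x / (x * x + y * y)) with (/ (1 + Rsqr (y * / x)))
        by (unfold Rsqr; field; split; nra).
      apply is_derive_Reals, is_derive_atan. }
    pose proof (differentiable_pt_lim_comp1 _ _ _ _ _ _ _ Hat
      (differentiable_pt_lim_Rmult _ _ _ _ _ _ _ _ Py
        (differentiable_pt_lim_comp1 _ _ _ _ _ _ _ Hinv Px))) as H.
    match type of H with differentiable_pt_lim _ _ _ ?a ?b =>
      replace (x / (x * x + y * y)) with b by (field; lra);
      replace (- y / (x * x + y * y)) with a by (field; lra)
    end. exact H.
Qed.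

(** * Sums of complex sequences *)

Definition abs_summable (a : nat -> C) : Prop := ex_series (fun n => Cmod (a n)).

Lemma abs_summable_Re_Im (a : nat -> C) : abs_summable a ->
  ex_series (fun n => Re (a n)) /\ ex_series (fun n => Im (a n)).
Proof.
  intros H; split; apply ex_series_Rabs;
    apply (@ex_series_le R_AbsRing R_CompleteNormedModule _ (fun n => Cmod (a n))); trivial;
    intros n; change norm with Rabs; rewrite Rabs_Rabsolu.
  - eapply Rle_trans; [apply Rmax_l|apply Rmax_Cmod].
  - eapply Rle_trans; [apply Rmax_r|apply Rmax_Cmod].
Qed.

Lemma abs_summable_le (a : nat -> C) (b : nat -> R) :
  (forall n, Cmod (a n) <= b n) -> ex_series b -> abs_summable a.
Proof.
  intros H Hb. apply (@ex_series_le R_AbsRing R_CompleteNormedModule _ b); trivial.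
  intros n. change norm with Rabs. rewrite Rabs_pos_eq by apply Cmod_ge_0. apply H.
Qed.

Lemma CSeries_ext (a b : nat -> C) : (forall n, a n = b n) -> CSeries a = CSeries b.
Proof.
  intros H. unfold CSeries. f_equal; apply Series_ext; intros n; now rewrite H.
Qed.

Lemma CSeries_minus (a b : nat -> C) : abs_summable a -> abs_summable b ->
  CSeries (fun n => (a n - b n)%C) = (CSeries a - CSeries b)%C.
Proof.
  intros Ha Hb.
  destruct (abs_summable_Re_Im _ Ha) as [Har Hai], (abs_summable_Re_Im _ Hb) as [Hbr Hbi].
  apply injective_projections;
    [exact (Series_minus _ _ Har Hbr)|exact (Series_minus _ _ Hai Hbi)].
Qed.

Lemma CSeries_scal (k : C) (a : nat -> C) : abs_summable a ->
  CSeries (fun n => (k * a n)%C) = (k * CSeries a)%C.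
Proof.
  intros Ha. destruct (abs_summable_Re_Im _ Ha) as [Hr Hi].
  unfold CSeries. apply injective_projections; simpl;
    rewrite <- !Series_scal_l.
  - exact (Series_minus _ _ (ex_series_scal (fst k) _ Hr) (ex_series_scal (snd k) _ Hi)).
  - exact (Series_plus _ _ (ex_series_scal (fst k) _ Hi) (ex_series_scal (snd k) _ Hr)).
Qed.

Lemma CSeries_shift (a : nat -> C) : a O = RtoC 0 ->
  CSeries a = CSeries (fun n => a (S n)).
Proof.
  intros H. unfold CSeries. f_equal; apply Series_incr_1_aux; now rewrite H.
Qed.

Lemma CSeries_incr (a : nat -> C) : abs_summable a ->
  CSeries a = (a O + CSeries (fun n => a (S n)))%C.
Proof.
  intros Ha. destruct (abs_summable_Re_Im _ Ha) as [Hr Hi].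
  unfold CSeries. apply injective_projections; simpl; now rewrite Series_incr_1.
Qed.

(** The sum is defined by its real and imaginary parts, which taken separately
    lose a factor. Projecting on the direction of the sum [s] itself reduces
    the triangle inequality to a real series:
    [|s|^2 = Re (conj s * s)] is the sum of [Re (conj s * a n) <= |s| |a n|]. *)
Lemma Cmod_CSeries_le (a : nat -> C) (b : nat -> R) :
  (forall n, Cmod (a n) <= b n) -> ex_series b -> Cmod (CSeries a) <= Series b.
Proof.
  intros H Hb.
  pose proof (abs_summable_le a b H Hb) as Ha.
  destruct (abs_summable_Re_Im _ Ha) as [Hr Hi].
  assert (Hab : Series (fun n => Cmod (a n)) <= Series b)
    by (apply Series_le; [intros n; split; [apply Cmod_ge_0|apply H]|exact Hb]).
  eapply Rle_trans; [|exact Hab].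
  set (s := CSeries a).
  (* The case [s = 0] is separate because the factor [|s|] is cancelled below. *)
  destruct (Req_dec (Cmod s) 0) as [E|E].
  { rewrite E, <- (Rmult_0_l (Series (fun n => Cmod (a n)))), <- Series_scal_l.
    apply Series_le; [|exact Ha].
    intros n. rewrite Rmult_0_l. split; [lra|apply Cmod_ge_0]. }
  assert (Hs : 0 < Cmod s) by (pose proof (Cmod_ge_0 s); lra).
  apply (Rmult_le_reg_l (Cmod s)); [exact Hs|].
  rewrite <- Series_scal_l.
  assert (Es : Cmod s * Cmod s = Series (fun n => Re s * Re (a n) + Im s * Im (a n))).
  { rewrite (Series_plus (fun n => Re s * Re (a n)) (fun n => Im s * Im (a n))
      (ex_series_scal (Re s) _ Hr) (ex_series_scal (Im s) _ Hi)).
    rewrite !Series_scal_l.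
    change (Series (fun n => Re (a n))) with (Re s).
    change (Series (fun n => Im (a n))) with (Im s).
    pose proof (Cmod2_alt s) as E2. lra. }
  rewrite Es.
  assert (Hex : ex_series (fun n => Cmod s * Cmod (a n)))
    by exact (ex_series_scal (Cmod s) _ Ha).
  assert (Hpt : forall n, Rabs (Re s * Re (a n) + Im s * Im (a n)) <= Cmod s * Cmod (a n)).
  { intros n. rewrite <- (Cmod_conj s), <- Cmod_mult.
    eapply Rle_trans; [|apply re_le_Cmod]. right. f_equal.
    unfold Re, Im. simpl. ring. }
  eapply Rle_trans; [apply Rle_abs|].
  eapply Rle_trans; [apply Series_Rabs|].
  - apply (@ex_series_le R_AbsRing R_CompleteNormedModule _ _) with (2 := Hex).
    intros n. change norm with Rabs. rewrite Rabs_Rabsolu. apply Hpt.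
  - apply Series_le; [|exact Hex]. intros n; split; [apply Rabs_pos|apply Hpt].
Qed.

(** * Power series with radius of convergence greater than one *)

(** Coefficients of a power series whose radius of convergence exceeds 1; this
    class is stable under termwise differentiation, so that a single lemma on
    derivatives can be iterated. *)
Definition geometric (a : nat -> C) : Prop :=
  exists M r : R, 0 < r < 1 /\ forall n, Cmod (a n) <= M * r ^ n.

Definition PS (a : nat -> C) (z : C) : C := CSeries (fun n => (a n * z ^ n)%C).

Definition PS_deriv (a : nat -> C) (n : nat) : C := (INR (S n) * a (S n))%C.

Lemma ex_series_geom_scal (M r : R) : 0 <= r < 1 -> ex_series (fun n => M * r ^ n).
Proof.
  intros Hr. apply (ex_series_scal (V := R_NormedModule) M (fun n => r ^ n)).
  apply ex_series_geom. rewrite Rabs_pos_eq; lra.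
Qed.

Lemma Cmod_term_le (a z : C) (B : R) (n : nat) : Cmod z <= 1 -> Cmod a <= B ->
  Cmod (a * z ^ n) <= B.
Proof.
  intros Hz Ha. rewrite Cmod_mult, Cmod_pow.
  assert (0 <= Cmod z ^ n <= 1).
  { pose proof (Cmod_ge_0 z). split; [now apply pow_le|].
    rewrite <- (pow1 n). apply pow_incr. lra. }
  pose proof (Cmod_ge_0 a). nra.
Qed.

Lemma PS_summable (a : nat -> C) (z : C) : geometric a -> Cmod z <= 1 ->
  abs_summable (fun n => (a n * z ^ n)%C).
Proof.
  intros (M & r & Hr & H) Hz.
  apply abs_summable_le with (b := fun n => M * r ^ n).
  - intros n. now apply Cmod_term_le.
  - apply ex_series_geom_scal. lra.
Qed.

Lemma Cmod_PS_le (a : nat -> C) (M r : R) (z : C) : 0 <= r < 1 ->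
  (forall n, Cmod (a n) <= M * r ^ n) -> Cmod z <= 1 -> Cmod (PS a z) <= M / (1 - r).
Proof.
  intros Hr H Hz. unfold PS.
  eapply Rle_trans; [apply (Cmod_CSeries_le _ (fun n => M * r ^ n))|].
  - intros n. now apply Cmod_term_le.
  - now apply ex_series_geom_scal.
  - rewrite Series_scal_l, Series_geom by (rewrite Rabs_pos_eq; lra). right. reflexivity.
Qed.

(** Any ratio between [r] and 1 absorbs the factor [n]: Bernoulli's inequality
    gives [n t <= (1 + t)^n], used with [1 + t = s / r]. *)
Lemma geometric_INR (a : nat -> C) : geometric a -> geometric (fun n => (INR n * a n)%C).
Proof.
  intros (M & r & Hr & H).
  set (s := (1 + r) / 2). set (t := s / r - 1).
  assert (Hs : 0 < s < 1) by (unfold s; lra).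
  assert (Ht : 0 < t).
  { unfold t. apply Rlt_0_minus, Rlt_div_r; unfold s; lra. }
  exists (M / t), s. split; [exact Hs|]. intros n.
  assert (HM : 0 <= M).
  { specialize (H O). rewrite pow_O in H. pose proof (Cmod_ge_0 (a O)). lra. }
  assert (Hb : INR n * t * r ^ n <= s ^ n).
  { replace s with ((1 + t) * r) by (unfold t; field; lra).
    rewrite Rpow_mult_distr. apply Rmult_le_compat_r; [apply pow_le; lra|].
    pose proof (poly n t Ht). lra. }
  rewrite Cmod_mult, Cmod_R, Rabs_pos_eq by apply pos_INR.
  eapply Rle_trans; [apply Rmult_le_compat_l; [apply pos_INR|apply H]|].
  apply (Rmult_le_reg_r t); [exact Ht|].
  replace (M / t * s ^ n * t) with (M * s ^ n) by (field; lra).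
  replace (INR n * (M * r ^ n) * t) with (M * (INR n * t * r ^ n)) by ring.
  now apply Rmult_le_compat_l.
Qed.

Lemma geometric_shift (a : nat -> C) : geometric a -> geometric (fun n => a (S n)).
Proof.
  intros (M & r & Hr & H). exists (M * r), r. split; [exact Hr|].
  intros n. eapply Rle_trans; [apply H|]. right. simpl. ring.
Qed.

Lemma geometric_unshift (a : nat -> C) : geometric (fun n => a (S n)) -> geometric a.
Proof.
  intros (M & r & Hr & H). exists (Cmod (a O) + M / r), r. split; [exact Hr|].
  assert (HM : 0 <= M / r).
  { specialize (H O). rewrite pow_O in H. pose proof (Cmod_ge_0 (a 1%nat)).
    apply Rdiv_le_0_compat; lra. }
  pose proof (Cmod_ge_0 (a O)). intros [|n].
  - rewrite pow_O. lra.
  - eapply Rle_trans; [apply H|].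
    assert (0 <= r ^ S n) by (apply pow_le; lra).
    replace (M * r ^ n) with (M / r * r ^ S n) by (simpl; field; lra). nra.
Qed.

Lemma geometric_scal (k : C) (a : nat -> C) :
  geometric a -> geometric (fun n => (k * a n)%C).
Proof.
  intros (M & r & Hr & H). exists (Cmod k * M), r. split; [exact Hr|].
  intros n. rewrite Cmod_mult, Rmult_assoc.
  apply Rmult_le_compat_l; [apply Cmod_ge_0|apply H].
Qed.

Lemma geometric_deriv (a : nat -> C) : geometric a -> geometric (PS_deriv a).
Proof. intros H. exact (geometric_shift _ (geometric_INR _ H)). Qed.

(** With [E n] the quantity estimated and [h = w - z], one has
    [E (n+1) = w * E n + n z^(n-1) h^2], so the constants grow at most like
    [n^2]. At [n = 0] the truncated exponent [pred 0] is harmless, being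
    multiplied by 0. *)
Lemma pow_taylor1 (z w : C) (n : nat) : Cmod z <= 1 -> Cmod w <= 1 ->
  Cmod (w ^ n - z ^ n - (w - z) * (INR n * z ^ pred n))
    <= INR n * INR n * (Cmod (w - z) * Cmod (w - z)).
Proof.
  intros Hz Hw. induction n as [|n IH].
  - simpl. replace (_ - _ - _)%C with (RtoC 0) by ring. rewrite Cmod_0. lra.
  - set (h2 := Cmod (w - z) * Cmod (w - z)) in *.
    set (E := (w ^ n - z ^ n - (w - z) * (INR n * z ^ pred n))%C) in *.
    assert (Hstep : (w ^ S n - z ^ S n - (w - z) * (INR (S n) * z ^ pred (S n)))%C
      = (w * E + INR n * z ^ pred n * ((w - z) * (w - z)))%C).
    { unfold E. rewrite S_INR, RtoC_plus. destruct n as [|m]; simpl.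
      - ring.
      - ring. }
    rewrite Hstep. eapply Rle_trans; [apply Cmod_triangle|].
    rewrite Cmod_mult, (Cmod_mult _ ((w - z) * (w - z))), (Cmod_mult (w - z)).
    fold h2.
    assert (0 <= h2) by (apply Rmult_le_pos; apply Cmod_ge_0).
    assert (Hn := pos_INR n).
    assert (Hc : Cmod (INR n * z ^ pred n) <= INR n).
    { apply Cmod_term_le; [exact Hz|]. rewrite Cmod_R, Rabs_pos_eq; lra. }
    pose proof (Cmod_ge_0 E). pose proof (Cmod_ge_0 w).
    assert (Cmod w * Cmod E <= INR n * INR n * h2) by nra.
    assert (Cmod (INR n * z ^ pred n) * h2 <= INR n * h2) by nra.
    rewrite S_INR. nra.
Qed.

(** Summing the second-order estimate for powers gives
    [|f(w) - f(z) - (w - z) f'(z)| <= K |w - z|^2] with [K] a bound for the sum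
    of [n^2 |a n|]; both points only have to lie in the closed disk. *)
Lemma is_Cderive_PS (a : nat -> C) (z : C) : geometric a -> Cmod z < 1 ->
  is_Cderive (PS a) z (PS (PS_deriv a) z).
Proof.
  intros Ha Hz.
  pose proof (geometric_INR _ (geometric_INR _ Ha)) as Ha2.
  assert (Hz1 : Cmod z <= 1) by lra.
  destruct Ha2 as (M & r & Hr & H2).
  assert (HM : 0 <= M).
  { specialize (H2 O). rewrite pow_O in H2.
    eapply Rle_trans in H2; [|apply Cmod_ge_0]. lra. }
  set (K := M / (1 - r)).
  assert (HK : 0 <= K) by (apply Rdiv_le_0_compat; lra).
  apply is_Cderive_iff. intros eps Heps.
  exists (Rmin (1 - Cmod z) (eps / (K + 1))).
  split; [apply Rmin_pos; [lra|apply Rdiv_lt_0_compat; lra]|].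
  intros w Hw.
  pose proof (Rmin_l (1 - Cmod z) (eps / (K + 1))).
  pose proof (Rmin_r (1 - Cmod z) (eps / (K + 1))).
  assert (Hw1 : Cmod w <= 1).
  { pose proof (Cmod_triangle z (w - z)%C) as T.
    replace (z + (w - z))%C with w in T by ring. lra. }
  set (h := Cmod (w - z)) in *. assert (Hh : 0 <= h) by apply Cmod_ge_0.
  assert (Hd : PS (PS_deriv a) z = CSeries (fun n => (INR n * a n * z ^ pred n)%C)).
  { rewrite (CSeries_shift (fun n => (INR n * a n * z ^ pred n)%C)) by (simpl; ring).
    reflexivity. }
  assert (Sd : abs_summable (fun n => (INR n * a n * z ^ pred n)%C)).
  { destruct (geometric_INR _ Ha) as (M' & r' & Hr' & H').
    apply abs_summable_le with (b := fun n => M' * r' ^ n).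
    - intros n. now apply Cmod_term_le.
    - apply ex_series_geom_scal. lra. }
  assert (Sd' : abs_summable (fun n => ((w - z) * (INR n * a n * z ^ pred n))%C)).
  { apply abs_summable_le with (b := fun n => h * Cmod (INR n * a n * z ^ pred n)).
    - intros n. rewrite Cmod_mult. unfold h. lra.
    - exact (ex_series_scal h _ Sd). }
  assert (Sw := PS_summable a w Ha Hw1). assert (Sz := PS_summable a z Ha Hz1).
  assert (Swz : abs_summable (fun n => (a n * w ^ n - a n * z ^ n)%C)).
  { apply abs_summable_le with (b := fun n => Cmod (a n * w ^ n) + Cmod (a n * z ^ n)).
    - intros n. unfold Cminus. eapply Rle_trans; [apply Cmod_triangle|].
      rewrite Cmod_opp. lra.
    - exact (ex_series_plus _ _ Sw Sz). }
  rewrite Hd, <- CSeries_scal by exact Sd. unfold PS.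
  rewrite <- CSeries_minus by assumption. rewrite <- CSeries_minus by assumption.
  apply Rle_trans with (K * (h * h)).
  - replace (K * (h * h)) with (Series (fun n => (M * (h * h)) * r ^ n)).
    2:{ rewrite Series_scal_l, Series_geom by (rewrite Rabs_pos_eq; lra).
        unfold K. field. lra. }
    apply Cmod_CSeries_le; [|apply ex_series_geom_scal; lra].
    intros n.
    replace (a n * w ^ n - a n * z ^ n - (w - z) * (INR n * a n * z ^ pred n))%C
      with (a n * (w ^ n - z ^ n - (w - z) * (INR n * z ^ pred n)))%C by ring.
    rewrite Cmod_mult.
    pose proof (pow_taylor1 z w n Hz1 Hw1) as T. fold h in T.
    specialize (H2 n).
    rewrite !Cmod_mult, !Cmod_R, !(Rabs_pos_eq (INR n)) in H2 by apply pos_INR.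
    pose proof (Cmod_ge_0 (a n)).
    eapply Rle_trans; [apply Rmult_le_compat_l; [assumption|exact T]|].
    replace (M * (h * h) * r ^ n) with ((M * r ^ n) * (h * h)) by ring.
    replace (Cmod (a n) * (INR n * INR n * (h * h)))
      with (INR n * (INR n * Cmod (a n)) * (h * h)) by ring.
    apply Rmult_le_compat_r; [nra|exact H2].
  - assert (h * (K + 1) <= eps).
    { apply Rle_div_r; lra. }
    nra.
Qed.

Lemma PS_incr (a : nat -> C) (z : C) : geometric a -> Cmod z <= 1 ->
  PS a z = (a O + z * PS (fun n => a (S n)) z)%C.
Proof.
  intros Ha Hz. unfold PS at 1. rewrite CSeries_incr by now apply PS_summable.
  f_equal; [simpl; ring|]. unfold PS.
  rewrite <- CSeries_scal by (apply PS_summable; [now apply geometric_shift|exact Hz]).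
  apply CSeries_ext. intros n. simpl. ring.
Qed.

Lemma PS_scal (k : C) (a : nat -> C) (z : C) : geometric a -> Cmod z <= 1 ->
  PS (fun n => (k * a n)%C) z = (k * PS a z)%C.
Proof.
  intros Ha Hz. unfold PS. rewrite <- CSeries_scal by now apply PS_summable.
  apply CSeries_ext. intros n. ring.
Qed.

Lemma PS_0 (a : nat -> C) : geometric a -> PS a (RtoC 0) = a O.
Proof. intros Ha. rewrite PS_incr; [ring|exact Ha|rewrite Cmod_0; lra]. Qed.

(** * Functions close to one are subordinate to the exponential *)

Lemma Rabs_atan_le (t : R) : Rabs (atan t) <= Rabs t.
Proof.
  destruct (MVT_gen atan 0 t (fun x => / (1 + Rsqr x))) as [x [_ E]].
  - intros x _. apply is_derive_atan.
  - intros x _. apply derivable_continuous_pt, derivable_pt_atan.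
  - rewrite atan_0, !Rminus_0_r in E. rewrite E, Rabs_mult.
    pose proof (Rle_0_sqr x) as Hx.
    assert (0 < / (1 + Rsqr x) <= 1).
    { split; [apply Rinv_0_lt_compat; lra|].
      rewrite <- Rinv_1. apply Rinv_le_contravar; lra. }
    rewrite (Rabs_pos_eq (/ _)) by lra. pose proof (Rabs_pos t). nra.
Qed.

Lemma ln_le_minus1 (x : R) : 0 < x -> ln x <= x - 1.
Proof. intros Hx. pose proof (exp_ineq1_le (ln x)). rewrite exp_ln in *; lra. Qed.

Lemma near_1_bounds (p : C) : Cmod (p - 1) <= 2 / 5 ->
  3 / 5 <= Re p /\ Rabs (Im p) <= 2 / 5 /\ 3 / 5 <= Cmod p <= 7 / 5.
Proof.
  intros H.
  assert (Hre : 3 / 5 <= Re p).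
  { pose proof (re_le_Cmod (p - 1)%C) as T.
    change (Re (p - 1)) with (Re p - 1) in T.
    pose proof (Rle_abs (- (Re p - 1))) as T2. rewrite Rabs_Ropp in T2. lra. }
  repeat split.
  - exact Hre.
  - pose proof (Rmax_Cmod (p - 1)%C) as T.
    pose proof (Rmax_r (Rabs (fst (p - 1)%C)) (Rabs (snd (p - 1)%C))) as T2.
    change (snd (p - 1)%C) with (Im p - 0) in *. rewrite Rminus_0_r in *. lra.
  - pose proof (re_le_Cmod p). pose proof (Rle_abs (Re p)). lra.
  - pose proof (Cmod_triangle 1 (p - 1)%C) as T. rewrite Cmod_1 in T.
    replace (1 + (p - 1))%C with p in T by ring. lra.
Qed.

(** The constant 2/5 makes both parts of [log p] at most [(2/5) / (3/5) = 2/3]: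
    [- ln |p| <= 1 / |p| - 1] and [|arg p| <= |Im p| / Re p]; and
    [(2/3)^2 + (2/3)^2 = 8/9 < 1]. *)
Lemma Cmod_Clog_lt_1 (p : C) : Cmod (p - 1) <= 2 / 5 -> Cmod (Clog p) < 1.
Proof.
  intros H. destruct (near_1_bounds p H) as (Hre & Him & Hm).
  assert (Hln : - (2 / 3) <= Re (Clog p) <= 2 / 3).
  { assert (E : Re (Clog p) = ln (Cmod p)).
    { unfold Clog. cbn [Re fst].
      replace (Re p * Re p + Im p * Im p) with (Cmod p * Cmod p)
        by (pose proof (Cmod2_alt p); lra).
      rewrite ln_mult by lra. field. }
    rewrite E. pose proof (ln_le_minus1 (Cmod p)) as T1.
    pose proof (ln_le_minus1 (/ Cmod p)) as T2.
    assert (Hi : 0 < / Cmod p <= 5 / 3).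
    { split; [apply Rinv_0_lt_compat; lra|].
      replace (5 / 3) with (/ (3 / 5)) by field. apply Rinv_le_contravar; lra. }
    rewrite ln_Rinv in T2 by lra. lra. }
  assert (Hat : - (2 / 3) <= Im (Clog p) <= 2 / 3).
  { apply Rabs_le_between. eapply Rle_trans; [apply Rabs_atan_le|].
    unfold Rdiv at 1. rewrite Rabs_mult, Rabs_inv, (Rabs_pos_eq (Re p)) by lra.
    apply Rle_div_l; lra. }
  pose proof (Cmod2_alt (Clog p)) as E. pose proof (Cmod_ge_0 (Clog p)). nra.
Qed.

(** A subordinating function is a logarithm of [p] of modulus less than [1 < PI],
    so it can only be the principal one. *)
Lemma class_Pe_near_1 (p : C -> C) :
  analytic_on_disk p -> p (RtoC 0) = RtoC 1 ->
  (forall z, unit_disk z -> Cmod (p z - 1) <= 2 / 5) -> class_Pe p.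
Proof.
  intros Ha H0 Hp. split; [exact Ha|split; [exact H0|]].
  assert (Hre : forall z, unit_disk z -> 0 < Re (p z)).
  { intros z Hz. destruct (near_1_bounds _ (Hp z Hz)). lra. }
  exists (fun z => Clog (p z)). repeat split.
  - intros z Hz. destruct (Ha z Hz) as [l Hl]. exists (l * / p z)%C.
    apply is_Cderive_comp; [|exact Hl]. apply is_Cderive_Clog. now apply Hre.
  - rewrite H0. apply Clog_1.
  - intros z Hz. apply Cmod_Clog_lt_1. now apply Hp.
  - intros z Hz. symmetry. apply Cexp_Clog. now apply Hre.
Qed.

(** * A coefficient criterion for exponential convexity *)

(** Comparison with geometric series of ratios 3/10 and 3/20 gives
    [|f''| <= 2/7] and [|f' - 1| <= 4/17] on the disk, so
    [|z f'' / f'| <= (2/7) / (13/17) = 34/91 < 2/5]. *)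
Lemma class_Ke_of_coef (f : C -> C) (a : nat -> C) :
  (forall z, unit_disk z -> f z = PS a z) ->
  a O = RtoC 0 -> a 1%nat = RtoC 1 ->
  (forall n, Cmod (a (S n)) <= (1 / 10) ^ n) ->
  class_Ke f.
Proof.
  intros Hf Ha0 Ha1 Ha.
  assert (Hg : geometric a).
  { apply geometric_unshift. exists 1, (1 / 10). split; [lra|].
    intros n. rewrite Rmult_1_l. apply Ha. }
  pose proof (geometric_deriv _ Hg) as Hg1.
  pose proof (geometric_deriv _ Hg1) as Hg2.
  set (F1 := PS (PS_deriv a)). set (F2 := PS (PS_deriv (PS_deriv a))).
  (* Derivatives at [z] only see the disk of radius [1 - |z|] around [z]. *)
  assert (Hloc : forall z w, Cmod (w - z) < 1 - Cmod z -> unit_disk w).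
  { intros z w Hw. unfold unit_disk. pose proof (Cmod_triangle z (w - z)%C) as T.
    replace (z + (w - z))%C with w in T by ring. lra. }
  assert (Df : forall z, unit_disk z -> is_Cderive f z (F1 z)).
  { intros z Hz. unfold unit_disk in Hz.
    apply (is_Cderive_ext_loc (PS a) f z _ (1 - Cmod z)); [lra| |now apply is_Cderive_PS].
    intros w Hw. symmetry. apply Hf. eapply Hloc, Hw. }
  assert (Ef : forall z, unit_disk z -> C_derive f z = F1 z).
  { intros z Hz. now apply is_C_derive_unique, Df. }
  assert (Df1 : forall z, unit_disk z -> is_Cderive (C_derive f) z (F2 z)).
  { intros z Hz. unfold unit_disk in Hz.
    apply (is_Cderive_ext_loc F1 _ z _ (1 - Cmod z)); [lra| |now apply is_Cderive_PS].
    intros w Hw. symmetry. apply Ef. eapply Hloc, Hw. }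
  assert (Ef1 : forall z, unit_disk z -> C_derive (C_derive f) z = F2 z).
  { intros z Hz. now apply is_C_derive_unique, Df1. }
  assert (Df2 : forall z, unit_disk z -> is_Cderive (C_derive (C_derive f)) z
                  (PS (PS_deriv (PS_deriv (PS_deriv a))) z)).
  { intros z Hz. unfold unit_disk in Hz.
    apply (is_Cderive_ext_loc F2 _ z _ (1 - Cmod z)); [lra| |now apply is_Cderive_PS].
    intros w Hw. symmetry. apply Ef1. eapply Hloc, Hw. }
  assert (HF2 : forall z, unit_disk z -> Cmod (F2 z) <= 2 / 7).
  { intros z Hz. replace (2 / 7) with (1 / 5 / (1 - 3 / 10)) by field.
    apply Cmod_PS_le; [lra| |apply Rlt_le, Hz].
    intros n. unfold PS_deriv. rewrite !Cmod_mult, !Cmod_R, !Rabs_pos_eq by apply pos_INR.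
    (* [(n+1)(n+2) / 10^(n+1) <= (1/5) (3/10)^n] *)
    assert (Hn : INR (S n) * INR (S (S n)) <= 2 * 3 ^ n).
    { induction n as [|n IH]; [simpl; lra|].
      rewrite (S_INR (S (S n))), <- tech_pow_Rmult. rewrite !S_INR in *.
      pose proof (pos_INR n). nra. }
    replace (1 / 5 * (3 / 10) ^ n) with (2 * 3 ^ n * (1 / 10) ^ S n).
    2:{ replace (3 / 10) with (3 * (1 / 10)) by field. rewrite Rpow_mult_distr. simpl. field. }
    rewrite <- Rmult_assoc. apply Rmult_le_compat; [|apply Cmod_ge_0|exact Hn|apply Ha].
    apply Rmult_le_pos; apply pos_INR. }
  assert (HF1 : forall z, unit_disk z -> Cmod (F1 z - 1) <= 4 / 17).
  { intros z Hz. unfold F1. rewrite PS_incr by (trivial; apply Rlt_le, Hz).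
    replace (PS_deriv a O) with (RtoC 1) by (unfold PS_deriv; rewrite Ha1; simpl; ring).
    match goal with |- context [PS ?b z] => set (g := PS b z); assert (Hgz : Cmod g <= 4 / 17) end.
    { replace (4 / 17) with (1 / 5 / (1 - 3 / 20)) by field.
      apply Cmod_PS_le; [lra| |apply Rlt_le, Hz].
      intros n. unfold PS_deriv. rewrite Cmod_mult, Cmod_R, Rabs_pos_eq by apply pos_INR.
      (* [(n+2) / 10^(n+1) <= (1/5) (3/20)^n], by Bernoulli *)
      replace (1 / 5 * (3 / 20) ^ n) with (2 * (1 + 1 / 2) ^ n * (1 / 10) ^ S n).
      2:{ replace (3 / 20) with ((1 + 1 / 2) * (1 / 10)) by field.
          rewrite Rpow_mult_distr. simpl. field. }
      apply Rmult_le_compat; [apply pos_INR|apply Cmod_ge_0| |apply Ha].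
      pose proof (poly n (1 / 2) ltac:(lra)). rewrite !S_INR. lra. }
    replace (1 + z * g - 1)%C with (z * g)%C by ring. rewrite Cmod_mult.
    unfold unit_disk in Hz. pose proof (Cmod_ge_0 z). pose proof (Cmod_ge_0 g). nra. }
  assert (HF1m : forall z, unit_disk z -> 13 / 17 <= Cmod (F1 z)).
  { intros z Hz. pose proof (HF1 z Hz) as T.
    pose proof (Cmod_triangle (F1 z) (- (F1 z - 1))%C) as T2.
    replace (F1 z + - (F1 z - 1))%C with (RtoC 1) in T2 by ring.
    rewrite Cmod_opp, Cmod_1 in T2. lra. }
  assert (HF1n : forall z, unit_disk z -> F1 z <> RtoC 0).
  { intros z Hz. apply Cmod_gt_0. pose proof (HF1m z Hz). lra. }
  assert (D0 : unit_disk (RtoC 0)) by (unfold unit_disk; rewrite Cmod_0; lra).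
  split; [split; [|split]|split].
  - intros z Hz. exists (F1 z). now apply Df.
  - rewrite Hf, PS_0; assumption.
  - rewrite Ef by exact D0. unfold F1. rewrite PS_0 by exact Hg1.
    unfold PS_deriv. rewrite Ha1. simpl. ring.
  - intros z Hz. rewrite Ef; auto.
  - apply class_Pe_near_1.
    + intros z Hz. eexists. unfold Cdiv.
      apply is_Cderive_plus; [exact (is_derive_const (RtoC 1) z)|].
      apply is_Cderive_mult.
      * apply is_Cderive_mult; [apply is_Cderive_id|].
        exact (Df2 z Hz).
      * apply (is_Cderive_comp Cinv (C_derive f)); [|exact (Df1 z Hz)].
        apply is_Cderive_inv. rewrite Ef; auto.
    + unfold Cdiv. ring.
    + intros z Hz. rewrite Ef, Ef1 by exact Hz.
      replace (1 + z * F2 z / F1 z - 1)%C with (z * F2 z / F1 z)%C by ring.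
      rewrite Cmod_div by auto. pose proof (HF1m z Hz).
      apply Rle_div_l; [lra|]. rewrite Cmod_mult.
      unfold unit_disk in Hz. pose proof (HF2 z Hz).
      pose proof (Cmod_ge_0 z). pose proof (Cmod_ge_0 (F2 z)). nra.
Qed.

(** * The normalized Struve function *)

(** The coefficient of [z^(n+1)] in [6 kappa (1 - u) / c]; the recursion is the
    ratio of consecutive terms of [u], starting at its term of degree one. *)
Fixpoint struve_coef (c : C) (kappa : R) (n : nat) : C :=
  match n with
  | O => RtoC 1
  | S m => (struve_coef c kappa m * (- c / 4 / ((5 / 2 + INR m) * (kappa + 1 + INR m))))%C
  end.

(** Here [m] stands for the modulus of [c]. After multiplication by [e = exp 1], [kappa] has the coefficient
    [2 t] with [t = 4 sin 1 + 3 - e], [m] has the coefficient [e (e + 1)],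
    and the remaining terms are positive. Since [13/5 <= e <= 3],
    [0 < 2 t <= 14 - 2 e <= e (e + 1)]. *)
Lemma struve_parameter_bounds (kappa m : R) : 0 <= m ->
  2 * kappa / exp 1 * (4 * sin 1 + 3 - exp 1)
     >= (exp 1 + 1) * m + 4 * (exp 1 - 1) ^ 3 + 6 * (exp 1 - 1) ^ 2
        + 6 / exp 1 - 12 / exp 1 ^ 2 ->
  0 < kappa /\ m <= kappa.
Proof.
  intros Hm H.
  assert (He3 := exp_le_3).
  assert (He : 13 / 5 <= exp 1).
  { pose proof (exp_ge_taylor 1 3 ltac:(lra)) as T.
    replace (sum_f_R0 _ _) with (8 / 3) in T by (simpl; field). lra. }
  set (e := exp 1) in *.
  assert (Hs : 0 < sin 1 <= 1).
  { split; [apply sin_pos_tech; lra|]. apply SIN_bound. }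
  set (X := 4 * (e - 1) ^ 3 + 6 * (e - 1) ^ 2 + 6 / e - 12 / e ^ 2).
  assert (HX : 0 < X).
  { unfold X.
    assert (6 / e - 12 / e ^ 2 = 6 * (e - 2) / e ^ 2) by (field; lra).
    assert (0 < 6 * (e - 2) / e ^ 2) by (apply Rdiv_lt_0_compat; nra).
    assert (0 < (e - 1) ^ 3) by (apply pow_lt; lra).
    assert (0 < (e - 1) ^ 2) by (apply pow_lt; lra). lra. }
  set (t := 4 * sin 1 + 3 - e) in *.
  assert (H' : (e * (e + 1)) * m + e * X <= kappa * (2 * t)).
  { replace (kappa * (2 * t)) with (e * (2 * kappa / e * t)) by (field; lra).
    unfold X. nra. }
  assert (Ht : 0 < 2 * t <= e * (e + 1)) by (unfold t; nra).
  assert (Hk : 0 < kappa) by nra.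
  split; [exact Hk|]. nra.
Qed.

Lemma RtoC_pos_neq_0 (x : R) : 0 < x -> RtoC x <> RtoC 0.
Proof. intros Hx E. apply RtoC_inj in E. lra. Qed.

Lemma pochhammer_neq_0 (x : R) (n : nat) : 0 < x -> pochhammer (RtoC x) n <> RtoC 0.
Proof.
  intros Hx. induction n as [|n IH]; simpl.
  - apply RtoC_pos_neq_0. lra.
  - apply Cmult_neq_0; [exact IH|]. rewrite <- RtoC_plus. apply RtoC_pos_neq_0.
    pose proof (pos_INR n). lra.
Qed.

Lemma struve_term (c : C) (kappa : R) (n : nat) : 0 < kappa ->
  ((- c / 4) ^ S n / (pochhammer (3 / 2) (S n) * pochhammer kappa (S n))
   = - c / (6 * kappa) * struve_coef c kappa n)%C.
Proof.
  intros Hk. pose proof (RtoC_pos_neq_0 _ Hk) as Hk0.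
  induction n as [|n IH].
  - simpl. field. repeat split; try exact Hk0; apply RtoC_pos_neq_0; lra.
  - pose proof (pos_INR n).
    assert (H1 : (5 / 2 + INR n)%C <> RtoC 0).
    { rewrite <- RtoC_div, <- RtoC_plus by lra. apply RtoC_pos_neq_0. lra. }
    assert (H2 : (kappa + 1 + INR n)%C <> RtoC 0).
    { rewrite <- !RtoC_plus. apply RtoC_pos_neq_0. lra. }
    assert (P1 : pochhammer (3 / 2) (S n) <> RtoC 0).
    { rewrite <- RtoC_div by lra. apply pochhammer_neq_0. lra. }
    assert (P2 := pochhammer_neq_0 kappa (S n) Hk).
    change (struve_coef c kappa (S n)) with
      (struve_coef c kappa n * (- c / 4 / ((5 / 2 + INR n) * (kappa + 1 + INR n))))%C.
    rewrite Cmult_assoc, <- IH.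
    change ((- c / 4) ^ S (S n))%C with (- c / 4 * (- c / 4) ^ S n)%C.
    change (pochhammer (3 / 2) (S (S n)))
      with (pochhammer (3 / 2) (S n) * (3 / 2 + INR (S n)))%C.
    change (pochhammer kappa (S (S n))) with (pochhammer kappa (S n) * (kappa + INR (S n)))%C.
    rewrite S_INR, RtoC_plus.
    replace (3 / 2 + (INR n + 1))%C with (5 / 2 + INR n)%C by (field; apply RtoC_pos_neq_0; lra).
    replace (kappa + (INR n + 1))%C with (kappa + 1 + INR n)%C by ring.
    generalize dependent (pochhammer (3 / 2) (S n)). intros p _ P1.
    generalize dependent (pochhammer kappa (S n)). intros q P2.
    generalize ((- c / 4) ^ S n)%C. intros y.
    generalize dependent (5 / 2 + INR n)%C. intros s H1.
    generalize dependent (kappa + 1 + INR n)%C. intros t H2.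
    field. auto.
Qed.

Theorem theorem4p3 (nu b c : C) (kappa : R)
  (hkappa : struve_kappa nu b = RtoC kappa)
  (hc : c <> RtoC 0)
  (hkappa_pole : forall n : nat, kappa <> - INR n)
  (hbound : 2 * kappa / exp 1 * (4 * sin 1 + 3 - exp 1)
            >= (exp 1 + 1) * Cmod c + 4 * (exp 1 - 1) ^ 3 + 6 * (exp 1 - 1) ^ 2
               + 6 / exp 1 - 12 / exp 1 ^ 2) :
  class_Ke (fun z : C => (6 * RtoC kappa * (1 - struve_u nu b c z) / c)%C).
Proof.
  destruct (struve_parameter_bounds kappa (Cmod c) (Cmod_ge_0 c) hbound) as [Hk Hck].
  assert (Hkc : RtoC kappa <> RtoC 0) by (apply RtoC_pos_neq_0; lra).
  set (a := fun n => match n with O => RtoC 0 | S m => struve_coef c kappa m end).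
  (* The ratio of consecutive coefficients is at most
     [|c| / (4 * (5/2) * (kappa + 1)) <= 1/10]. *)
  assert (Ha : forall n, Cmod (a (S n)) <= (1 / 10) ^ n).
  { simpl. induction n as [|n IH]; simpl.
    - rewrite Cmod_1. lra.
    - pose proof (pos_INR n).
      rewrite Cmod_mult, Rmult_comm.
      apply Rmult_le_compat; try apply Cmod_ge_0; [|exact IH].
      replace (((5 / 2 + INR n) * (kappa + 1 + INR n)))%C
        with (RtoC ((5 / 2 + INR n) * (kappa + 1 + INR n))).
      2:{ rewrite RtoC_mult, !RtoC_plus, RtoC_div by lra. reflexivity. }
      rewrite !Cmod_div, Cmod_opp, !Cmod_R by (apply RtoC_pos_neq_0; nra).
      rewrite !Rabs_pos_eq by nra.
      apply Rle_div_l; nra. }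
  apply (class_Ke_of_coef _ a); [|reflexivity|reflexivity|exact Ha].
  intros z Hz.
  (* The coefficients of [u] itself, with the constant term split off. *)
  set (k := (- c / (6 * kappa))%C).
  set (d := fun n => match n with O => RtoC 1 | S m => (k * struve_coef c kappa m)%C end).
  assert (Hz1 : Cmod z <= 1) by apply Rlt_le, Hz.
  assert (Ge : geometric (struve_coef c kappa)).
  { exists 1, (1 / 10). split; [lra|]. intros n. rewrite Rmult_1_l. apply Ha. }
  assert (Gd : geometric d) by exact (geometric_unshift d (geometric_scal k _ Ge)).
  assert (Ga : geometric a) by exact (geometric_unshift a Ge).
  assert (E : struve_u nu b c z = PS d z).
  { unfold struve_u, PS. rewrite hkappa. apply CSeries_ext. intros [|n].
    - simpl. field.
    - rewrite struve_term by exact Hk. reflexivity. }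
  rewrite E, (PS_incr d z Gd Hz1), (PS_incr a z Ga Hz1). cbn [a d].
  rewrite PS_scal by assumption.
  change (fun n => struve_coef c kappa n) with (struve_coef c kappa).
  unfold k. field. repeat split; auto; apply RtoC_pos_neq_0; lra.
Qed.
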